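(* Let $\alpha>0$, $\beta>0$ and $|\xi|>1$; put $\varepsilon=1$ if $\xi<-1$ and $\varepsilon=-1$ if $\xi>1$. Let $c_0$ be the linear functional associated to the measure $|x-\xi|(1-x)^{\alpha-1}(1+x)^{\beta-1}dx=\varepsilon(x-\xi)(1-x)^{\alpha-1}(1+x)^{\beta-1}dx$ on $]-1,1[$, and $c_1$ the one associated to $(1-x)^{\alpha}(1+x)^{\beta}dx$ on $]-1,1[$. The monic polynomials $P_n(x,\xi)$ orthogonal with respect to $c_0$ satisfy $$P_n(x,\xi)=N_n^{(\alpha-1,\beta-1)}(x,\xi)\,\frac{k_n^{(\alpha-1,\beta-1)}}{P_n^{(\alpha-1,\beta-1)}(\xi)},\qquad N_n^{(\alpha-1,\beta-1)}(x,\xi)=\sum_{j=0}^n\frac{P_j^{(\alpha-1,\beta-1)}(x)P_j^{(\alpha-1,\beta-1)}(\xi)}{k_j^{(\alpha-1,\beta-1)}}.$$ The square norm $k_n^{(0)}=c_0(P_n(x,\xi)^2)$ and the coefficient $\sigma_n$ of the coherence relation are given by $$k_n^{(0)}=-\varepsilon\,k_n^{(\alpha-1,\beta-1)}\,\frac{P_{n+1}^{(\alpha-1,\beta-1)}(\xi)}{P_n^{(\alpha-1,\beta-1)}(\xi)}\quad(n\ge0),$$ $$\sigma_n=\frac{4n(n+\alpha)(n+\beta)(n+\alpha+\beta-1)}{(2n+\alpha+\beta-1)(2n+\alpha+\beta)^2(2n+\alpha+\beta+1)}\,\frac{P_n^{(\alpha-1,\beta-1)}(\xi)}{P_{n+1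}^{(\alpha-1,\beta-1)}(\xi)}\quad(n\ge1).$$
   Context: For $a,b>-1$, $P_n^{(a,b)}$ denotes the monic Jacobi polynomial of degree $n$, orthogonal with respect to $(1-x)^{a}(1+x)^{b}dx$ on $]-1,1[$, and $k_n^{(a,b)}=\int_{-1}^1(P_n^{(a,b)}(x))^2(1-x)^{a}(1+x)^{b}dx$. The pair $(c_0,c_1)$ is coherent: $\sigma_n$ ($n\ge1$) is the real number such that $T_n(x)=\frac{P_{n+1}'(x,\xi)}{n+1}-\sigma_n\frac{P_n'(x,\xi)}{n}$, where $T_n=P_n^{(\alpha,\beta)}$ is the monic orthogonal polynomial with respect to $c_1$ and $'$ is the derivative in $x$. *)

(* Defs.v *)
From HB Require Import structures.
From mathcomp Require Import all_boot all_order all_algebra.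
From mathcomp Require Import all_classical all_reals all_analysis.
From mathcomp Require Import lra.
Set Implicit Arguments.
Unset Strict Implicit.
Unset Printing Implicit Defensive.
Import Order.TTheory GRing.Theory Num.Theory.
Import numFieldNormedType.Exports.
Local Open Scope classical_set_scope.
Local Open Scope ring_scope.

(* [Rintegral] is a Lebesgue integral with values in [R] and default value on
   non-integrable functions; every weight used below is integrable on
   ]-1, 1[, the exponents being greater than -1. *)
Definition weight_functional (R : realType) (w : R -> R) (p : {poly R}) : R :=
  \int[lebesgue_measure]_(x in `]-1, 1[) (p.[x] * w x).

Definition jacobi_weight (R : realType) (a b : R) : R -> R :=
  fun x => (1 - x) `^ a * (1 + x) `^ b.

Definition monic_orthogonal (R : realType) (c : {poly R} -> R)
    (P : nat -> {poly R}) : Prop :=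
  (forall n, P n \is monic /\ size (P n) = n.+1) /\
  (forall m n, m <> n -> c (P m * P n) = 0).

(* For a, b > -1 the weight is positive and integrable, so this determines P:
   P n is then the monic Jacobi polynomial P_n^(a,b). *)
Definition is_monic_jacobi (R : realType) (a b : R) (P : nat -> {poly R}) :
    Prop :=
  monic_orthogonal (weight_functional (jacobi_weight a b)) P.

Definition sqnorm (R : realType) (c : {poly R} -> R) (P : nat -> {poly R})
    (n : nat) : R :=
  c (P n ^+ 2).

(* N_n(x, xi) as a polynomial in x. *)
Definition kernel_poly (R : realType) (c : {poly R} -> R)
    (P : nat -> {poly R}) (n : nat) (xi : R) : {poly R} :=
  \sum_(j < n.+1) ((P j).[xi] / sqnorm c P j) *: P j.

Definition coherence_relation (R : realType) (P T : nat -> {poly R}) (n : nat)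
    (s : R) : Prop :=
  T n = n.+1%:R^-1 *: (P n.+1)^`() - s *: (n%:R^-1 *: (P n)^`()).

(* Only used for |xi| > 1. *)
Definition eps (R : realType) (xi : R) : R := if xi < -1 then 1 else -1.

Definition c1 (R : realType) (alpha beta : R) : {poly R} -> R :=
  weight_functional (jacobi_weight alpha beta).

Definition c0 (R : realType) (alpha beta xi : R) : {poly R} -> R :=
  weight_functional
    (fun x => `|x - xi| * jacobi_weight (alpha - 1) (beta - 1) x).

Lemma c0_eps (R : realType) (alpha beta xi : R) (p : {poly R}) :
  1 < `|xi| ->
  c0 alpha beta xi p =
  weight_functional
    (fun x => eps xi * (x - xi) * jacobi_weight (alpha - 1) (beta - 1) x) p.
Proof.
move=> hxi; apply: eq_Rintegral => x; rewrite inE /= in_itv /= => /andP[x1 x2].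
congr (_ * (_ * _)); rewrite /eps; case: ifPn => h.
  by rewrite mul1r ger0_norm //; lra.
rewrite mulN1r ler0_norm //.
have : 1 < xi by move: hxi; rewrite lter_normr => /orP[]; lra.
lra.
Qed.

(* Main.v *)
Require Import Defs.
From HB Require Import structures.
From mathcomp Require Import all_boot all_order all_algebra.
From mathcomp Require Import all_classical all_reals all_analysis.
From mathcomp Require Import measurable_realfun.
From mathcomp Require Import ring lra.
Set Implicit Arguments.
Unset Strict Implicit.
Unset Printing Implicit Defensive.
Import Order.TTheory GRing.Theory Num.Theory.
Import numFieldNormedType.Exports.
Local Open Scope classical_set_scope.
Local Open Scope ring_scope.

(** Let [L] be the functional of the Jacobi weight with exponents
    [alpha - 1, beta - 1] and [J] its monic orthogonal polynomials. Up to sign,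
    [c0 p = L ((x - xi) p)], and [c1 p = L ((1 - x^2) p)].
    - If [q] has degree at most [n], then [q - q(xi)] is divisible by [x - xi],
      so [L (P_n q) = q(xi) L (P_n)]. Taking [q = J_n] gives [J_n(xi) <> 0] and
      [L (P_n) = k_n / J_n(xi)]; the coefficients of [P_n] in the basis [J_j]
      give the kernel formula. Since [(x - xi) P_n] is [L]-orthogonal to degree
      less than [n], it is [J_{n+1} - (J_{n+1}(xi) / J_n(xi)) J_n], which gives
      the square norm of [P_n].
    - Integration by parts reads
      [L ((1 - x^2) f' q) = - L (f A q)] with
      [A q = (1 - x^2) q' + (beta - alpha - (alpha + beta) x) q]. With
      [f = P_{n+1} / (n+1) - sigma P_n / n], the right-hand side is
      [- (A q)(xi) (L P_{n+1} / (n+1) - sigma L P_n / n)] for [q] of degree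
      less than [n], and it vanishes when
      [sigma = n / (n+1) * k_{n+1} / k_n * J_n(xi) / J_{n+1}(xi)].
    - The ratio [k_{n+1} / k_n] is read off the two coefficients of [J_n] below
      the leading one, which the differential equation
      [A (J_n') = - n (n - 1 + alpha + beta) J_n] determines. *)

(** * The fundamental theorem of calculus on an open interval *)

Section ImproperFTC.
Variables (R : realType) (a b : R).
Hypothesis ab : a < b.
Notation mu := (@lebesgue_measure R).

(** The denominators start at 3, so the step is at most a third of [b - a] and [lo n < hi n] already
    holds at [n = 0]. *)
Let lo (n : nat) : R := a + (b - a) / n.+3%:R.
Let hi (n : nat) : R := b - (b - a) / n.+3%:R.
Let E n : set R := `[lo n, hi n]%classic.

Let step_gt0 n : 0 < (b - a) / n.+3%:R.
Proof. by rewrite divr_gt0// subr_gt0. Qed.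

Let lo_hi n : lo n < hi n.
Proof.
have h : (b - a) / n.+3%:R <= (b - a) / 3.
  by rewrite ler_pM2l ?subr_gt0// lef_pV2 ?posrE// ler_nat.
by rewrite /lo /hi; move: h; set t := _ / n.+3%:R ; move: ab; lra.
Qed.

Let step_cvg0 : (b - a) / n.+3%:R @[n --> \oo] --> (0 : R).
Proof.
rewrite -(mulr0 (b - a)); apply: cvgMr.
have := @cvg_harmonic R; rewrite -(cvg_shiftn 2) /= => h.
by apply: cvg_trans h; apply: near_eq_cvg; apply: nearW => n; rewrite /= addn2.
Qed.

Let lo_cvg : lo n @[n --> \oo] --> a.
Proof. by rewrite -[X in _ --> X]addr0; apply: cvgD; [exact: cvg_cst|]. Qed.

Let hi_cvg : hi n @[n --> \oo] --> b.
Proof. by rewrite -[X in _ --> X]subr0; apply: cvgB; [exact: cvg_cst|]. Qed.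

Let subE n : E n `<=` `]a, b[%classic.
Proof.
move=> x; rewrite /E /= !in_itv /= => /andP[h1 h2].
have := step_gt0 n; move: h1 h2; rewrite /lo /hi; set t := _ / _ => h1 h2 h3.
by apply/andP; split; lra.
Qed.

(** Gives both the exhaustion of the open interval and the pointwise convergence of the truncations
    of [f]. *)
Let nearE x : x \in `]a, b[ -> \forall n \near \oo, x \in E n.
Proof.
rewrite in_itv /= => /andP[ax xb]; near=> n; apply/mem_set.
rewrite /E /= in_itv /=; apply/andP; split; apply: ltW; near: n.
  by apply: (cvgr_lt _ lo_cvg).
by apply: (cvgr_gt _ hi_cvg).
Unshelve. all: by end_near. Qed.

Let ndE : nondecreasing_seq E.
Proof.
move=> m n mn; rewrite subsetEset => x.
rewrite /E /= !in_itv /= => /andP[h1 h2].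
have : (b - a) / n.+3%:R <= (b - a) / m.+3%:R.
  by rewrite ler_pM2l ?subr_gt0// lef_pV2 ?posrE// ler_nat.
move: h1 h2; rewrite /lo /hi; set t := _ / n.+3%:R; set u := _ / m.+3%:R.
by move=> h1 h2 h3; apply/andP; split; lra.
Qed.

Let bigcupE : \bigcup_n E n = `]a, b[%classic.
Proof.
apply/seteqP; split=> [x [n _]|x xab]; first exact: subE.
have [n _ h] := nearE xab; exists n => //; apply/set_mem/h => /=; exact: leqnn.
Qed.

Variables (F f : R -> R) (la lb : R).
Hypothesis dF : forall x : R, x \in `]a, b[ -> is_derive x 1 F (f x).
Hypothesis cf : {in `]a, b[, continuous f}.
Hypothesis Fa : F x @[x --> a^'+] --> la.
Hypothesis Fb : F x @[x --> b^'-] --> lb.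

Let Flo : F (lo n) @[n --> \oo] --> la.
Proof.
move/cvg_at_rightP : Fa; apply; split => [n|]; last exact: lo_cvg.
by rewrite /lo ltrDl.
Qed.

Let Fhi : F (hi n) @[n --> \oo] --> lb.
Proof.
move/cvg_at_leftP : Fb; apply; split => [n|]; last exact: hi_cvg.
by rewrite /hi gtrBl.
Qed.

Let intE n : (\int[mu]_(x in E n) (f x)%:E = (F (hi n) - F (lo n))%:E)%E.
Proof.
have sub x : x \in `[lo n, hi n] -> x \in `]a, b[ by exact: (subE (n := n)).
have cF x : x \in `[lo n, hi n] -> F y @[y --> x] --> F x.
  move=> /sub xab; apply: differentiable_continuous.
  by apply/derivable1_diffP; have ? := dF xab; exact: ex_derive.
rewrite EFinB; apply: continuous_FTC2 => //.
- by apply: continuous_in_subspaceT => x /set_mem/sub; exact: cf.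
- split.
  + by move=> x /subset_itv_oo_cc/sub/dF ?; exact: ex_derive.
  + by apply: cvg_at_right_filter; apply: cF; rewrite in_itv /= lexx ltW.
  + by apply: cvg_at_left_filter; apply: cF; rewrite in_itv /= lexx ltW.
- by move=> x /subset_itv_oo_cc/sub/dF ?; rewrite derive1E derive_val.
Qed.

Let mf : measurable_fun `]a, b[ f.
Proof.
by apply: open_continuous_measurable_fun => // x /set_mem; exact: cf.
Qed.

Let intE_lim l : (\int[mu]_(x in E n) (f x)%:E @[n --> \oo] --> l)%E ->
  l = (lb - la)%:E.
Proof.
move=> h; apply: (cvg_unique (@ereal_hausdorff R) h).
have h' : ((F (hi n) - F (lo n))%:E @[n --> \oo] --> (lb - la)%:E)%E.
  by apply: cvg_EFin; [exact: nearW|apply: cvgB; [exact: Fhi|exact: Flo]].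
by apply: cvg_trans h'; apply: near_eq_cvg; apply: nearW => n; rewrite intE.
Qed.

(** Monotone convergence: for nonnegative [f] the integrals over [E n] tend to the integral over the
    whole interval, and this limit is the finite number [lb - la]. *)
Lemma ge0_integrable_FTC_open : (forall x : R, x \in `]a, b[ -> 0 <= f x) ->
  mu.-integrable `]a, b[ (EFin \o f).
Proof.
move=> f0; apply/integrableP; split; first exact/measurable_EFinP.
have -> : (\int[mu]_(x in `]a, b[) `|(EFin \o f) x| =
    \int[mu]_(x in `]a, b[) (f x)%:E)%E.
  by apply: eq_integral => x /set_mem xab; rewrite /= ger0_norm ?f0.
have : (\int[mu]_(x in E n) (f x)%:E @[n --> \oo] -->
    \int[mu]_(x in \bigcup_n E n) (f x)%:E)%E.
  apply: ge0_nondecreasing_set_cvg_integral => //.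
  - by move=> n; exact: measurable_itv.
  - move=> n; apply/measurable_EFinP; apply: measurable_funS mf => //.
  - by move=> n x /subE h; rewrite lee_fin f0.
rewrite bigcupE => h.
by rewrite (intE_lim h) ltry.
Qed.

(** Without a sign condition, monotone convergence gives way to dominated convergence, with [|f|]
    dominating the truncations [g n]. *)
Lemma Rintegral_FTC_open : mu.-integrable `]a, b[ (EFin \o f) ->
  \int[mu]_(x in `]a, b[) f x = lb - la.
Proof.
move=> intf.
pose g n := (EFin \o f) \_ (E n).
have mE n : measurable (E n) by exact: measurable_itv.
have mg n : measurable_fun `]a, b[ (g n).
  apply/measurable_restrict => //.
  by apply: measurable_funS (measurable_int _ intf) => //; exact: subIsetr.
have h : (\int[mu]_(x in `]a, b[) g n x @[n --> \oo] -->
    \int[mu]_(x in `]a, b[) (f x)%:E)%E.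
  (* Of the three conclusions of dominated convergence, only the last, the convergence of the
     integrals, is kept. *)
  apply: (and3_rec (fun _ _ => id) (@dominated_convergence _ _ _ mu
    `]a, b[%classic (measurable_itv _) g (EFin \o f) (abse \o (EFin \o f))
    mg _ _ _ _)).
  - exact: measurable_int intf.
  - apply/aeW => x xab; apply: cvg_near_cst.
    by near=> n; rewrite /g patchE ifT//; near: n; exact: nearE.
  - exact: integrable_abse.
  - apply/aeW => x n xab; rewrite /g patchE; case: ifP => // _.
    by rewrite abse0 abse_ge0.
rewrite /Rintegral (@intE_lim (\int[mu]_(x in `]a, b[) (f x)%:E)%E)//.
apply: cvg_trans h; apply: near_eq_cvg.
by apply: nearW => n; rewrite -integral_mkcondr setIidr//; exact: subE.
Unshelve. all: by end_near. Qed.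

End ImproperFTC.

(** * Jacobi weights *)

Section JacobiWeight.
Variable R : realType.
Notation mu := (@lebesgue_measure R).
Implicit Types (a b r x : R) (p : {poly R}).

Lemma is_derive_horner p x : is_derive x 1 (horner p) p^`().[x].
Proof.
by split; [exact: derivable_horner|rewrite -derive1E derivE].
Qed.

Lemma is_derive_powR_1p r x : -1 < x ->
  is_derive x 1 (fun y : R => (1 + y) `^ r) (r * (1 + x) `^ (r - 1)).
Proof.
move=> x1; have x0 : 0 < 1 + x by lra.
have h := is_derive1_powR r x0.
have h2 : is_derive x 1 (fun y : R => 1 + y) 1.
  rewrite -[X in is_derive _ _ _ X]add0r.
  exact: (@is_deriveD _ _ _ (cst (1 : R)) id).
by have := @is_derive1_comp _ _ (fun y : R => 1 + y) x _ _ h h2; rewrite mulr1.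
Qed.

Lemma is_derive_powR_1m r x : x < 1 ->
  is_derive x 1 (fun y : R => (1 - y) `^ r) (- (r * (1 - x) `^ (r - 1))).
Proof.
move=> x1; have x0 : 0 < 1 - x by lra.
have h := is_derive1_powR r x0.
have h2 : is_derive x 1 (fun y : R => 1 - y) (- 1).
  rewrite -[X in is_derive _ _ _ X]add0r.
  exact: (@is_deriveB _ _ _ (cst (1 : R)) id).
by have := @is_derive1_comp _ _ (fun y : R => 1 - y) x _ _ h h2; rewrite mulrN1.
Qed.

Lemma cvg_powR_1p_left r : 0 < r -> (1 + x) `^ r @[x --> (-1)^'+] --> (0 : R).
Proof.
move=> r0; apply: (cvg_comp _ _ _ (powR_cvg0 r0)) => A [e /= e0 He].
exists e => // y /= ye y1; apply: He => /=; last by rewrite -subr_gt0; lra.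
by move: ye; rewrite sub0r normrN -opprD normrN.
Qed.

Lemma cvg_powR_1m_right r : 0 < r -> (1 - x) `^ r @[x --> 1^'-] --> (0 : R).
Proof.
move=> r0; apply: (cvg_comp _ _ _ (powR_cvg0 r0)) => A [e /= e0 He].
exists e => // y /= ye y1; apply: He => /=; last by rewrite subr_gt0.
by rewrite sub0r normrN.
Qed.

Lemma continuous_powR_1p r x : -1 < x ->
  {for x, continuous (fun y : R => (1 + y) `^ r)}.
Proof.
move=> x1; apply/differentiable_continuous/derivable1_diffP.
by have ? := is_derive_powR_1p r x1; exact: ex_derive.
Qed.

Lemma continuous_powR_1m r x : x < 1 ->
  {for x, continuous (fun y : R => (1 - y) `^ r)}.
Proof.
move=> x1; apply/differentiable_continuous/derivable1_diffP.
by have ? := is_derive_powR_1m r x1; exact: ex_derive.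
Qed.

Lemma cvg_powR_1p_right r : (1 + x) `^ r @[x --> 1^'-] --> ((1 + 1) `^ r : R).
Proof. by apply: cvg_at_left_filter; apply: continuous_powR_1p; lra. Qed.

Lemma cvg_powR_1m_left r :
  (1 - x) `^ r @[x --> (-1)^'+] --> ((1 - -1) `^ r : R).
Proof. by apply: cvg_at_right_filter; apply: continuous_powR_1m; lra. Qed.

(** The antiderivative [(1 + x)^(r + 1) / (r + 1)] has finite limits at both ends because
    [r + 1 > 0]. *)
Lemma integrable_powR_1p r : -1 < r ->
  mu.-integrable `]-1, 1[ (EFin \o (fun x : R => (1 + x) `^ r)).
Proof.
move=> r1; have r0 : 0 < r + 1 by lra.
apply: (@ge0_integrable_FTC_open _ _ _ _
  (fun x => (r + 1)^-1 * (1 + x) `^ (r + 1)) _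
  ((r + 1)^-1 * 0) ((r + 1)^-1 * (1 + 1) `^ (r + 1))); first by lra.
- move=> x; rewrite in_itv /= => /andP[x1 _].
  have h := is_derive_powR_1p (r + 1) x1.
  have := is_deriveZ (r + 1)^-1 h.
  by rewrite addrK -mulr_algl mulr_algl scalerA mulVf ?gt_eqF// scale1r.
- by move=> x; rewrite in_itv /= => /andP[x1 _]; exact: continuous_powR_1p.
- by apply: cvgMr; exact: cvg_powR_1p_left.
- by apply: cvgMr; exact: cvg_powR_1p_right.
- by move=> *; exact: powR_ge0.
Qed.

Lemma integrable_powR_1m r : -1 < r ->
  mu.-integrable `]-1, 1[ (EFin \o (fun x : R => (1 - x) `^ r)).
Proof.
move=> r1; have r0 : 0 < r + 1 by lra.
apply: (@ge0_integrable_FTC_open _ _ _ _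
  (fun x => - (r + 1)^-1 * (1 - x) `^ (r + 1)) _
  (- (r + 1)^-1 * (1 - -1) `^ (r + 1)) (- (r + 1)^-1 * 0)); first by lra.
- move=> x; rewrite in_itv /= => /andP[_ x1].
  have h := is_derive_powR_1m (r + 1) x1.
  have := is_deriveZ (- (r + 1)^-1) h.
  by rewrite addrK scaleNr scalerN opprK scalerA mulVf ?gt_eqF// scale1r.
- by move=> x; rewrite in_itv /= => /andP[_ x1]; exact: continuous_powR_1m.
- by apply: cvgMr; exact: cvg_powR_1m_left.
- by apply: cvgMr; exact: cvg_powR_1m_right.
- by move=> *; exact: powR_ge0.
Qed.

Lemma powRS x r : 0 < x -> x `^ (r + 1) = x * x `^ r.
Proof.
by move=> x0; rewrite powRD ?(gt_eqF x0) ?implybT// powRr1 ?ltW// mulrC.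
Qed.

Lemma jacobi_weight_ge0 a b x : 0 <= jacobi_weight a b x.
Proof. by rewrite mulr_ge0 ?powR_ge0. Qed.

Lemma jacobi_weight_gt0 a b x : x \in `]-1, 1[ -> 0 < jacobi_weight a b x.
Proof.
by rewrite in_itv /= => /andP[h1 h2]; rewrite mulr_gt0 ?powR_gt0//; lra.
Qed.

Lemma continuous_horner_jacobi_weight p a b :
  {in `]-1, 1[, continuous (fun x : R => p.[x] * jacobi_weight a b x)}.
Proof.
move=> x; rewrite in_itv /= => /andP[x1 x2].
apply: cvgM; first exact: continuous_horner.
by apply: cvgM; [exact: continuous_powR_1m|exact: continuous_powR_1p].
Qed.

(* 2 = (1 - x) + (1 + x), so the weight is a sum of two terms with only one
   singular factor each, the other one being bounded. *)
Lemma jacobi_weight_le a b x : -1 < a -> -1 < b -> x \in `]-1, 1[ ->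
  jacobi_weight a b x <=
  2 `^ (a + 1) * (1 + x) `^ b + 2 `^ (b + 1) * (1 - x) `^ a.
Proof.
rewrite in_itv /= => a1 b1 /andP[x1 x2].
have u0 : 0 < 1 - x by lra.
have v0 : 0 < 1 + x by lra.
have ha : (1 - x) `^ (a + 1) <= 2 `^ (a + 1).
  by apply: ge0_ler_powR; rewrite ?nnegrE; lra.
have hb : (1 + x) `^ (b + 1) <= 2 `^ (b + 1).
  by apply: ge0_ler_powR; rewrite ?nnegrE; lra.
move: ha hb; rewrite /jacobi_weight [(1 - x) `^ (a + 1)]powRS//.
rewrite [(1 + x) `^ (b + 1)]powRS//.
have := powR_ge0 (1 - x) a; have := powR_ge0 (1 + x) b.
set A := (1 - x) `^ a; set B := (1 + x) `^ b => B0 A0 ha hb.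
have := ler_wpM2r B0 ha; have := ler_wpM2r A0 hb.
by have := mulr_ge0 A0 B0; nra.
Qed.

Lemma horner_bound p x : `|x| <= 1 -> `|p.[x]| <= \sum_(i < size p) `|p`_i|.
Proof.
move=> x1; rewrite horner_coef; apply: le_trans (ler_norm_sum _ _ _) _.
apply: ler_sum => i _; rewrite normrM normrX ler_piMr//.
by rewrite exprn_ile1.
Qed.

(** The polynomial is bounded by [M] on the interval, and the weight by a sum of two integrable
    powers. *)
Lemma integrable_horner_jacobi_weight p a b : -1 < a -> -1 < b ->
  mu.-integrable `]-1, 1[ (EFin \o (fun x : R => p.[x] * jacobi_weight a b x)).
Proof.
move=> a1 b1; pose M := \sum_(i < size p) `|p`_i|.
pose g x := M * (2 `^ (a + 1) * (1 + x) `^ b + 2 `^ (b + 1) * (1 - x) `^ a).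
apply: (@le_integrable _ _ _ mu `]-1, 1[%classic _ _ (EFin \o g)) => //.
- apply/measurable_EFinP; apply: open_continuous_measurable_fun => //.
  by move=> x /set_mem; exact: continuous_horner_jacobi_weight.
- move=> x xI; rewrite /= lee_fin normrM (ger0_norm (jacobi_weight_ge0 _ _ _)).
  apply: le_trans (ler_norm _); apply: ler_pM => //.
  + exact: jacobi_weight_ge0.
  + apply: horner_bound; move: xI; rewrite /= in_itv /= ler_norml.
    by move=> /andP[/ltW -> /ltW ->].
  + exact: jacobi_weight_le.
- pose u (x : R) := (1 + x) `^ b; pose v (x : R) := (1 - x) `^ a.
  have -> : EFin \o g = (fun x : R => M%:E *
      ((2 `^ (a + 1))%:E * (EFin \o u) x +
       (2 `^ (b + 1))%:E * (EFin \o v) x))%E.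
    by [].
  apply: integrableZl => //.
  apply: integrableD => //; apply: integrableZl => //.
  + exact: integrable_powR_1p.
  + exact: integrable_powR_1m.
Qed.

(** * Definiteness and linearity of the Jacobi functional *)

Lemma countable_roots p : p != 0 -> countable [set x | root p x].
Proof.
move=> p0; apply: finite_set_countable; apply: contrapT => /infinite_set_fset.
move=> /(_ (size p)) [B Bp sB].
have := @max_poly_roots _ p (finmap.enum_fset B) p0 _ (finmap.fset_uniq B).
rewrite ltnNge sB => /(_ _)/negP; apply => //; apply/allP => x xB.
exact: Bp.
Qed.

(** A nonnegative integrand with zero integral vanishes almost everywhere. As the weight is
    positive, a nonzero [p] would make the interval the union of a null set and a set of roots of
    [p], hence null, against its length 2. *)
Lemma jacobi_functional_definite a b p : -1 < a -> -1 < b ->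
  weight_functional (jacobi_weight a b) (p ^+ 2) = 0 -> p = 0.
Proof.
move=> a1 b1; rewrite /weight_functional /Rintegral => h.
have i2 := integrable_horner_jacobi_weight (p ^+ 2) a1 b1.
pose I : set R := `]-1, 1[%classic.
pose f (x : R) := (p ^+ 2).[x] * jacobi_weight a b x.
have : (\int[mu]_(x in I) `|(EFin \o f) x| = 0)%E.
  have <- : (\int[mu]_(x in I) (f x)%:E)%E = 0%E.
    by rewrite -[LHS]fineK ?h//; exact: integrable_fin_num i2.
  apply: eq_integral => x _ /=; rewrite ger0_norm//.
  by rewrite mulr_ge0 ?jacobi_weight_ge0// horner_exp sqr_ge0.
move=> /(ae_eq_integral_abs mu (measurable_itv _) (measurable_int _ i2)).1.
move=> [N [mN N0 sN]].
apply: contrapT => /eqP p0.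
have nI : mu (`]-1, 1[%classic : set R) = 0%E.
  apply: measure_negligible => //.
  apply: (@negligibleS _ _ _ _ (N `|` [set x | root p x])); last first.
    apply: negligibleU; first by exists N; split.
    apply/negligibleP.
      by apply: countable_measurable => //; exact: countable_roots.
    exact: countable_lebesgue_measure0 (countable_roots p0).
  move=> x xI; have [rx|rx] := boolP (root p x); [by right|left].
  apply: sN => /= /(_ xI) [] /eqP; rewrite horner_exp mulf_eq0 expf_eq0 /=.
  by rewrite -rootE (negbTE rx) gt_eqF// jacobi_weight_gt0.
by move: nI; rewrite lebesgue_measure_itv /= lte_fin ifT; [case; lra|lra].
Qed.


Lemma scalar_jacobi_functional a b : -1 < a -> -1 < b ->
  scalar (weight_functional (jacobi_weight a b)).
Proof.
move=> a1 b1 k p q; have ip := integrable_horner_jacobi_weight p a1 b1.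
have iq := integrable_horner_jacobi_weight q a1 b1.
have ikp := integrable_horner_jacobi_weight (k *: p) a1 b1.
rewrite /weight_functional -RintegralZl// -RintegralD//; last first.
  rewrite (_ : (fun x => k * _) =
    fun x => (k *: p).[x] * jacobi_weight a b x)//.
  by apply/funext => x; rewrite hornerZ mulrA.
by apply: eq_Rintegral => x _; rewrite /= hornerD hornerZ; ring.
Qed.

Lemma jacobi_functionalS a b p :
  weight_functional (jacobi_weight (a + 1) (b + 1)) p =
  weight_functional (jacobi_weight a b) ((1 - 'X^2) * p).
Proof.
apply: eq_Rintegral => x /set_mem; rewrite /= in_itv /= => /andP[x1 x2].
by rewrite /jacobi_weight !powRS ?hornerE /=; [ring|lra..].
Qed.

(* ((1 - x^2) w)' = (b - a - (a + b + 2) x) w for the weight w, and (1 - x^2) w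
   vanishes at both ends. *)
Lemma jacobi_pearson a b p : -1 < a -> -1 < b ->
  weight_functional (jacobi_weight a b)
    ((1 - 'X^2) * p^`() + ((b - a)%:P - (a + b + 2) *: 'X) * p) = 0.
Proof.
move=> a1 b1; set q := _ + _.
pose F (x : R) := p.[x] * ((1 - x) `^ (a + 1) * (1 + x) `^ (b + 1)).
rewrite -[RHS](subrr 0); apply: (@Rintegral_FTC_open _ _ _ _ F); first by lra.
- move=> x; rewrite in_itv /= => /andP[x1 x2].
  have dp := is_derive_horner p x.
  have da := is_derive_powR_1m (a + 1) x2.
  have db := is_derive_powR_1p (b + 1) x1.
  have h := is_deriveM dp (is_deriveM da db).
  apply: (@is_derive_eq _ _ _ F _ _ _ _ h).
  rewrite /q /jacobi_weight /GRing.scale /= !fctE !hornerE !powRS; [|lra..].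
  by rewrite !addrK /=; ring.
- exact: continuous_horner_jacobi_weight.
- rewrite -(mulr0 p.[-1]); apply: cvgM.
    by apply: cvg_at_right_filter; exact: continuous_horner.
  rewrite -(mulr0 ((1 - -1) `^ (a + 1))); apply: cvgM.
    exact: cvg_powR_1m_left.
  by apply: cvg_powR_1p_left; lra.
- rewrite -(mulr0 p.[1]); apply: cvgM.
    by apply: cvg_at_left_filter; exact: continuous_horner.
  rewrite -(mul0r ((1 + 1) `^ (b + 1))); apply: cvgM.
    by apply: cvg_powR_1m_right; lra.
  exact: cvg_powR_1p_right.
- exact: integrable_horner_jacobi_weight.
Qed.

Lemma c1E alpha beta p : c1 alpha beta p =
  weight_functional (jacobi_weight (alpha - 1) (beta - 1)) ((1 - 'X^2) * p).
Proof. by rewrite -jacobi_functionalS !subrK. Qed.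

Lemma c0E alpha beta xi p : 0 < alpha -> 0 < beta -> 1 < `|xi| ->
  c0 alpha beta xi p =
  eps xi * weight_functional (jacobi_weight (alpha - 1) (beta - 1))
             (('X - xi%:P) * p).
Proof.
move=> a0 b0 xi1; rewrite c0_eps// /weight_functional -RintegralZl//.
  by apply: eq_Rintegral => x _; rewrite !hornerE /=; ring.
by apply: integrable_horner_jacobi_weight; lra.
Qed.

End JacobiWeight.

(** * Orthogonal polynomials *)

Section OrthogonalPolynomials.
Variables (R : realType) (L : {scalar {poly R}}) (J : nat -> {poly R}).
Hypothesis oJ : monic_orthogonal L J.
Implicit Types (p q r : {poly R}) (n : nat).

Lemma orth_size n : size (J n) = n.+1.
Proof. by case: oJ => /(_ n)[]. Qed.

Lemma orth_coef_top n : (J n)`_n = 1.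
Proof.
by have [/(_ n)[/monicP Jm sJ] _] := oJ; move: Jm; rewrite lead_coefE sJ.
Qed.

Lemma orth_coef_gt n j : (n < j)%N -> (J n)`_j = 0.
Proof. by move=> nj; rewrite nth_default// orth_size. Qed.

(** One step of the descent by degree: [J n] is monic of degree [n], so the subtraction cancels the
    top coefficient. *)
Lemma size_sub_top n q : (size q <= n.+1)%N ->
  (size (q - q`_n *: J n)%R <= n)%N.
Proof.
move=> sq; apply/leq_sizeP => j; rewrite leq_eqVlt => /predU1P[<-|nj].
  by rewrite coefB coefZ orth_coef_top mulr1 subrr.
by rewrite coefB coefZ orth_coef_gt// mulr0 subr0 nth_default// (leq_trans sq).
Qed.

Lemma orth_lt n q : (size q <= n)%N -> L (J n * q) = 0.
Proof.
(* The bound on the degree is separated from the index of [J n], so that the induction runs on [m]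
   with [n] fixed. *)
suff: forall m p, (m <= n)%N -> (size p <= m)%N -> L (J n * p) = 0.
  by apply; exact: leqnn.
elim=> [|m IH] {}q mn sq.
  by move: sq; rewrite leqn0 size_poly_eq0 => /eqP ->; rewrite mulr0 raddf0.
rewrite -(subrK (q`_m *: J m) q) mulrDr raddfD /= IH ?size_sub_top ?(ltnW mn)//.
by rewrite add0r -scalerAr linearZ /= oJ.2 ?mulr0// => e; rewrite e ltnn in mn.
Qed.

Lemma orth_top n q : (size q <= n.+1)%N -> L (J n * q) = q`_n * sqnorm L J n.
Proof.
move=> sq; rewrite -{1}(subrK (q`_n *: J n) q) mulrDr raddfD /=.
by rewrite orth_lt ?size_sub_top// add0r -scalerAr linearZ.
Qed.

(** Taking [q = r] gives [L (r^2) = 0]. Polynomial identities below are proved by applying this to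
    the difference of their sides. *)
Lemma orth_eq0 n r : (forall p, L (p ^+ 2) = 0 -> p = 0) ->
  (size r <= n)%N -> (forall q, (size q <= n)%N -> L (r * q) = 0) -> r = 0.
Proof. by move=> defL sr h; apply: defL; rewrite expr2 h. Qed.

Lemma orth_expansion n q : (forall m, sqnorm L J m != 0) ->
  (size q <= n)%N ->
  q = \sum_(j < n) (L (J j * q) / sqnorm L J j) *: J j.
Proof.
move=> k0; elim: n q => [|n IH] q sq.
  by rewrite big_ord0; apply/eqP; rewrite -size_poly_eq0 -leqn0.
rewrite big_ord_recr /= orth_top// mulfK//.
rewrite -{1}(subrK (q`_n *: J n) q) {1}[q - _]IH ?size_sub_top//; congr (_ + _).
apply: eq_bigr => j _; congr ((_ / _) *: _).
rewrite mulrBr raddfB /= -scalerAr linearZ /= oJ.2 ?mulr0 ?subr0// => e.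
by have := ltn_ord j; rewrite e ltnn.
Qed.

Lemma sqnorm_neq0 n :
  (forall p, L (p ^+ 2) = 0 -> p = 0) -> sqnorm L J n != 0.
Proof.
move=> defL; apply/eqP => /defL J0; have := orth_coef_top n.
by rewrite J0 coef0 => /eqP; rewrite eq_sym oner_eq0.
Qed.

End OrthogonalPolynomials.

(** * Multiplying the functional by a linear factor *)

Section Christoffel.
Variables (R : realType) (L M : {scalar {poly R}}) (J P : nat -> {poly R}).
Variables (e xi : R).
Hypotheses (oJ : monic_orthogonal L J) (oP : monic_orthogonal M P).
Hypothesis defL : forall p, L (p ^+ 2) = 0 -> p = 0.
Hypotheses (e0 : e != 0) (ME : forall p, M p = e * L (('X - xi%:P) * p)).
Implicit Types (p q r : {poly R}) (n : nat).
Notation k := (sqnorm L J).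

Lemma christoffel_eval n q : (size q <= n.+1)%N ->
  L (P n * q) = q.[xi] * L (P n).
Proof.
move=> sq; have /factor_theorem[s qs] : root (q - q.[xi]%:P) xi.
  by rewrite /root !hornerE subrr.
have ss : (size s <= n)%N.
  have [->|s0] := eqVneq s 0; first by rewrite size_poly0.
  have : (size (s * ('X - xi%:P))%R <= n.+1)%N.
    rewrite -qs (leq_trans (size_polyD _ _))// geq_max sq size_polyN.
    by rewrite (leq_trans (size_polyC_leq1 _)).
  by rewrite size_Mmonic ?monicXsubC// size_XsubC addn2.
have /eqP : M (P n * s) = 0 by exact: orth_lt.
rewrite ME mulf_eq0 (negbTE e0) /= => /eqP h.
rewrite -[in LHS](subrK q.[xi]%:P q) qs mulrDr raddfD /=.
rewrite (_ : P n * _ = ('X - xi%:P) * (P n * s)); last by ring.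
by rewrite h add0r mulrC mul_polyC linearZ.
Qed.

(** Both sides are [L (P_n J_n)]: by orthogonality of [J_n], [P_n] being monic, and by evaluating
    [J_n] at [xi]. *)
Lemma christoffel_mass n : k n = (J n).[xi] * L (P n).
Proof.
have sJ := orth_size oJ.
have sP := orth_size oP.
rewrite -christoffel_eval ?sJ// mulrC (orth_top oJ) ?sP//.
by rewrite (orth_coef_top oP) mul1r.
Qed.

(** [J_n(xi)] is a factor of the nonzero norm [k n]; the location of the zeros of [J_n] does not
    enter. *)
Lemma orth_xi_neq0 n : (J n).[xi] != 0.
Proof.
have := sqnorm_neq0 oJ n defL; rewrite christoffel_mass mulf_eq0 negb_or.
by case/andP.
Qed.

Lemma christoffel_massE n : L (P n) = k n / (J n).[xi].
Proof. by rewrite christoffel_mass mulrAC mulfV ?orth_xi_neq0// mul1r. Qed.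

Lemma christoffel_kernel n : P n = (k n / (J n).[xi]) *: kernel_poly L J n xi.
Proof.
have sJ := orth_size oJ.
have sP := orth_size oP.
rewrite {1}(orth_expansion oJ (fun m => sqnorm_neq0 oJ m defL) (eq_leq (sP n))).
rewrite /kernel_poly scaler_sumr; apply: eq_bigr => j _.
rewrite scalerA -christoffel_massE [J j * P n]mulrC.
rewrite christoffel_eval ?sJ ?ltn_ord//.
by rewrite mulrAC mulrC.
Qed.

Lemma christoffel_formula n :
  ('X - xi%:P) * P n = J n.+1 - ((J n.+1).[xi] / (J n).[xi]) *: J n.
Proof.
have sJ := orth_size oJ.
have sP := orth_size oP.
set U : {poly R} := _ * P n.
have sU : (size (U - J n.+1)%R <= n.+1)%N.
  have sz : (size U <= n.+2)%N.
    have P0 : P n != 0 by rewrite -size_poly_eq0 sP.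
    by rewrite /U mulrC size_Mmonic ?monicXsubC// size_XsubC sP addn2.
  have U1 : U`_n.+1 = 1.
    rewrite /U mulrBl coefB coefXM /= (orth_coef_top oP) mul_polyC coefZ.
    by rewrite (orth_coef_gt oP)// mulr0 subr0.
  by have := size_sub_top oJ sz; rewrite U1 scale1r.
pose t := (U - J n.+1)`_n.
have r0 : U - J n.+1 - t *: J n = 0.
  apply: (orth_eq0 (n := n) defL); first by have := size_sub_top oJ sU.
  move=> q sq; rewrite !mulrBl !raddfB /= -scalerAl linearZ /=.
  rewrite (orth_lt oJ sq) mulr0 subr0 (orth_lt oJ) ?(leqW sq)// subr0.
  apply/(mulfI e0); rewrite mulr0 -mulrA -ME; exact: orth_lt oP _ _ sq.
(* The left factor vanishes at [xi], so evaluating there determines [t]. *)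
have tE : t = - ((J n.+1).[xi] / (J n).[xi]).
  have /(congr1 (horner^~ xi)) := r0.
  rewrite /U !hornerE subrr mul0r sub0r => /eqP.
  rewrite subr_eq0 => /eqP h.
  by rewrite -mulNr h mulfK ?orth_xi_neq0.
by move/eqP: r0; rewrite subr_eq0 subr_eq addrC tE scaleNr => /eqP.
Qed.

(** As [J_n] is monic, the norm is also [M (P_n J_n)]; in the formula for [(x - xi) P_n], only the
    [J_n] term pairs nontrivially with [J_n]. *)
Lemma christoffel_sqnorm n :
  sqnorm M P n = - e * k n * ((J n.+1).[xi] / (J n).[xi]).
Proof.
have sJ := orth_size oJ.
have := @orth_top _ M P oP n (J n) (eq_leq (sJ n)).
rewrite (orth_coef_top oJ) mul1r => <-.
rewrite ME mulrA christoffel_formula mulrBl raddfB /= -scalerAl linearZ /=.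
rewrite -[X in _ - _ * L X]expr2 -[L (J n ^+ 2)]/(k n).
rewrite (orth_lt oJ) ?sJ//; ring.
Qed.

End Christoffel.

(** * The Pearson equation *)

Section Pearson.
Variables (R : realType) (L : {scalar {poly R}}) (J : nat -> {poly R}).
Variables (d s : R).
Implicit Types (p q r : {poly R}) (n : nat).

(** For a weight [w] with [((1 - x^2) w)' = (d - s x) w], this is [((1 - x^2) w p)' / w]. *)
Definition pearson_op p : {poly R} :=
  (1 - 'X^2) * p^`() + (d%:P - s *: 'X) * p.

Hypothesis oJ : monic_orthogonal L J.
Hypothesis defL : forall p, L (p ^+ 2) = 0 -> p = 0.
Hypothesis pearsonL : forall p, L (pearson_op p) = 0.

(** The product rule splits [pearson_op (p q)], on which [L] vanishes, into [(1 - x^2) p' q] and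
    [p * pearson_op q]. *)
Lemma pearson_parts p q :
  L ((1 - 'X^2) * (p^`() * q)) = - L (p * pearson_op q).
Proof.
apply/eqP; rewrite -addr_eq0 -raddfD -(pearsonL (p * q)); apply/eqP.
by congr (L _); rewrite /pearson_op derivM; ring.
Qed.

Lemma coef_pearson_op p j : (pearson_op p)`_j =
  p`_j.+1 * j.+1%:R - (if j is j'.+1 then p`_j' * (j'%:R + s) else 0)
  + d * p`_j.
Proof.
rewrite /pearson_op mulrBl mul1r mulrBl -scalerAl mul_polyC.
rewrite !(coefD, coefB, coefN).
rewrite coefXnM !coefZ coefXM coef_deriv.
case: j => [|[|j]] /=; rewrite ?subn2 /= ?coef_deriv; ring.
Qed.

Lemma size_pearson_op p n : (size p <= n)%N -> (size (pearson_op p) <= n.+1)%N.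
Proof.
move=> sp; apply/leq_sizeP => -[//|j] nj; rewrite coef_pearson_op.
have p0 i : (n <= i)%N -> p`_i = 0.
  by move=> ni; rewrite nth_default// (leq_trans sp).
have nj1 : (n <= j.+1)%N by exact: ltnW.
by rewrite (p0 j nj) (p0 _ nj1) (p0 _ (leqW nj1)) !mul0r mulr0 subr0 addr0.
Qed.

Lemma size_deriv_le p n : (size p <= n.+1)%N -> (size p^`() <= n)%N.
Proof.
move=> sp; apply/leq_sizeP => j nj.
by rewrite coef_deriv nth_default ?mul0rn// (leq_trans sp).
Qed.

(** The top coefficients of the two sides agree, so their difference has degree less than [n]. Two
    integrations by parts move the second-order operator onto [q], whose degree it does not raise,
    and orthogonality applies. *)
Lemma pearson_ode n :
  pearson_op (J n)^`() = - (n%:R * (n%:R - 1 + s)) *: J n.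
Proof.
have Jn := orth_coef_top oJ n; have Jgt := orth_coef_gt oJ.
apply/eqP; rewrite scaleNr -addr_eq0; apply/eqP.
apply: (orth_eq0 (n := n) defL).
  apply/leq_sizeP => j; rewrite coefD coefZ coef_pearson_op !coef_deriv.
  rewrite leq_eqVlt => /predU1P[<-|nj].
    rewrite Jn (Jgt n n.+1)// (Jgt n n.+2)//.
    by case: (n) Jn => [|m] Jm; rewrite ?coef_deriv ?Jm; ring.
  rewrite (Jgt _ _ nj) (Jgt _ _ (leqW nj)) (Jgt _ _ (leqW (leqW nj))).
  by case: j nj => [//|j] nj; rewrite coef_deriv Jgt//; ring.
move=> q sq; rewrite mulrDl raddfD /= -scalerAl linearZ /= orth_lt//.
rewrite mulr0 addr0.
rewrite mulrC -[LHS]opprK -pearson_parts [q^`() * _]mulrC pearson_parts opprK.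
(* For [n > 0] the derivative lowers the degree bound by one and [pearson_op] restores it; for
   [n = 0], [q] is zero. *)
rewrite orth_lt//; case: n sq {Jn} => [|m] sq; last first.
  exact/size_pearson_op/size_deriv_le.
move: sq; rewrite !leqn0 !size_poly_eq0 => /eqP ->.
by rewrite /pearson_op !deriv0 !mulr0 addr0.
Qed.

(** Comparison of the coefficients of [x^m] in the differential equation; the factor is
    [(m + 1)(m + s) - m (m - 1 + s)]. *)
Lemma orth_subcoef1 m : (2 * m%:R + s) * (J m.+1)`_m = - d * m.+1%:R.
Proof.
have J1 := orth_coef_top oJ m.+1; have Jgt := orth_coef_gt oJ.
have := congr1 (fun p : {poly R} => p`_m) (pearson_ode m.+1).
rewrite coef_pearson_op coefZ !coef_deriv (Jgt m.+1 m.+2)// J1 => /eqP.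
rewrite -subr_eq0 => /eqP h.
apply/eqP; rewrite -subr_eq0; apply/eqP; apply: etrans h.
by case: m {Jgt J1} => [|m]; rewrite ?coef_deriv; ring.
Qed.

(** The same comparison two degrees below the top, with factor
    [(m + 2)(m + 1 + s) - m (m - 1 + s)]. *)
Lemma orth_subcoef2 m : 2 * (2 * m%:R + 1 + s) * (J m.+2)`_m =
  - (m.+1%:R * (m.+2%:R + d * (J m.+2)`_m.+1)).
Proof.
have J1 := orth_coef_top oJ m.+2.
have := congr1 (fun p : {poly R} => p`_m) (pearson_ode m.+2).
rewrite coef_pearson_op coefZ !coef_deriv J1 => /eqP.
rewrite -subr_eq0 => /eqP h.
apply/eqP; rewrite -subr_eq0; apply/eqP; apply: etrans h.
by case: m {J1} => [|m]; rewrite ?coef_deriv; ring.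
Qed.

(** This is the three-term recurrence: [b] cancels the coefficient of degree [n + 2] in [r], and
    pairing [r] with [J_{n+1}] gives [k_{n+2}] on one side and the coefficient of degree [n + 1]
    times [k_{n+1}] on the other. *)
Lemma orth_sqnormS n : sqnorm L J n.+2 =
  ((J n.+2)`_n - (J n.+3)`_n.+1
   - ((J n.+2)`_n.+1 - (J n.+3)`_n.+2) * (J n.+2)`_n.+1) * sqnorm L J n.+1.
Proof.
have sJ := orth_size oJ.
have J1 := orth_coef_top oJ; have Jgt := orth_coef_gt oJ.
set b := (J n.+2)`_n.+1 - (J n.+3)`_n.+2.
pose r := 'X * J n.+2 - J n.+3 - b *: J n.+2.
have sr : (size r <= n.+2)%N.
  apply/leq_sizeP => j; rewrite /r coefB coefZ coefB coefXM.
  case: j => [//|j] /=; rewrite ltnS leq_eqVlt => /predU1P[<-|].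
    by rewrite J1 mulr1 subrr.
  rewrite leq_eqVlt => /predU1P[<-|nj]; first by rewrite !J1 Jgt//; ring.
  by rewrite !Jgt//; [ring|exact: ltnW].
have := orth_top oJ sr.
rewrite /r !mulrBr !raddfB /= -scalerAr linearZ /=.
rewrite !(oJ.2 n.+1) ?mulr0 ?subr0//; last first.
  by apply/eqP; rewrite ltn_eqF.
rewrite (_ : J n.+1 * ('X * _) = J n.+2 * ('X * J n.+1)); last by ring.
rewrite orth_top//; last first.
  by rewrite (leq_trans (size_polyMleq _ _))// size_polyX sJ.
by rewrite coefXM J1 mul1r => ->; rewrite !(coefB, coefZ, coefXM).
Qed.

End Pearson.

Lemma jacobi_sqnorm_ratio (R : realType) (L : {scalar {poly R}})
    (J : nat -> {poly R}) (alpha beta : R) (m : nat) :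
  0 < alpha -> 0 < beta ->
  monic_orthogonal L J ->
  (forall p, L (p ^+ 2) = 0 -> p = 0) ->
  (forall p, L (pearson_op (beta - alpha) (alpha + beta) p) = 0) ->
  let n : R := m.+1%:R in
  sqnorm L J m.+2 =
    4 * (n + 1) * (n + alpha) * (n + beta) * (n + alpha + beta - 1)
    / ((2 * n + alpha + beta - 1) * (2 * n + alpha + beta) ^+ 2
       * (2 * n + alpha + beta + 1)) * sqnorm L J m.+1.
Proof.
move=> a0 b0 oJ defL pL n.
rewrite (orth_sqnormS oJ); congr (_ * _).
have := orth_subcoef1 oJ defL pL m.+1; have := orth_subcoef1 oJ defL pL m.+2.
have := orth_subcoef2 oJ defL pL m; have := orth_subcoef2 oJ defL pL m.+1.
have m0 : 0 <= m%:R :> R by exact: ler0n.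
have E1 : m.+1%:R = m%:R + 1 :> R by rewrite natr1.
have E2 : m.+2%:R = m%:R + 1 + 1 :> R by rewrite !natr1.
have E3 : m.+3%:R = m%:R + 1 + 1 + 1 :> R by rewrite !natr1.
rewrite /n E3 E2 E1; move: (m%:R : R) m0 => t t0.
set q3 := (J m.+3)`_m.+1; set q2 := (J m.+2)`_m.
set p3 := (J m.+3)`_m.+2; set p2 := (J m.+2)`_m.+1 => hq3 hq2 hp3 hp2.
have n1 : 2 * (t + 1) + (alpha + beta) != 0 by lra.
have n2 : 2 * (t + 1 + 1) + (alpha + beta) != 0 by lra.
have n3 : 2 * (2 * t + 1 + (alpha + beta)) != 0 by lra.
have n4 : 2 * (2 * (t + 1) + 1 + (alpha + beta)) != 0 by lra.
(* The four coefficients are replaced by their values, the second ones first since these involve the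
   first ones. *)
rewrite -(mulKf n3 q2) -(mulKf n4 q3) hq2 hq3.
rewrite -(mulKf n1 p2) -(mulKf n2 p3) hp2 hp3.
by field; repeat (apply/andP; split); lra.
Qed.

(** * Coherence *)

Section Coherence.
Variables (R : realType) (L M N : {scalar {poly R}}).
Variables (J P T : nat -> {poly R}) (d s e xi : R).
Hypotheses (oJ : monic_orthogonal L J) (oP : monic_orthogonal M P).
Hypothesis oT : monic_orthogonal N T.
Hypothesis defL : forall p, L (p ^+ 2) = 0 -> p = 0.
Hypothesis defN : forall p, N (p ^+ 2) = 0 -> p = 0.
Hypothesis pearsonL : forall p, L (pearson_op d s p) = 0.
Hypotheses (e0 : e != 0) (ME : forall p, M p = e * L (('X - xi%:P) * p)).
Hypothesis NE : forall p, N p = L ((1 - 'X^2) * p).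
Notation k := (sqnorm L J).

Lemma coherence_relation_ex n : (0 < n)%N ->
  coherence_relation P T n
    (n%:R / n.+1%:R * (k n.+1 / k n) * ((J n).[xi] / (J n.+1).[xi])).
Proof.
move=> n0; set sg := _ * _.
have P1 := orth_coef_top oP; have Pgt := orth_coef_gt oP.
have T1 := orth_coef_top oT; have Tgt := orth_coef_gt oT.
have nz m : m.+1%:R != 0 :> R by rewrite pnatr_eq0.
have kn0 := sqnorm_neq0 oJ n defL; have Jn0 := orth_xi_neq0 oJ oP defL e0 ME.
have nR0 : n%:R != 0 :> R by rewrite pnatr_eq0 -lt0n.
(* [F] is an antiderivative of the right-hand side of the coherence relation, ready for integration
   by parts. *)
pose F := n.+1%:R^-1 *: P n.+1 - (sg / n%:R) *: P n.
have F' : F^`() = n.+1%:R^-1 *: (P n.+1)^`() - sg *: (n%:R^-1 *: (P n)^`()).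
  by rewrite derivB !derivZ scalerA.
rewrite /coherence_relation -F'; apply/eqP; rewrite -subr_eq0; apply/eqP.
apply: (orth_eq0 (n := n) defN).
  apply/leq_sizeP => j; rewrite coefB coef_deriv /F coefB !coefZ leq_eqVlt.
  move=> /predU1P[<-|nj]; last first.
    by rewrite Tgt// !Pgt ?mulr0 ?subrr ?mul0rn ?subrr// ltnW.
  by rewrite T1 P1 Pgt// mulr0 subr0 -mulrnAr mulVf// subrr.
move=> q sq; rewrite mulrBl raddfB /= orth_lt// sub0r NE.
rewrite (pearson_parts pearsonL) opprK.
have sA := size_pearson_op d s sq.
have LF : L (F * pearson_op d s q) = n.+1%:R^-1 * L (P n.+1 * pearson_op d s q)
    - sg / n%:R * L (P n * pearson_op d s q).
  rewrite /F; move: (sg / _) => c.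
  by rewrite mulrBl raddfB /= -!scalerAl !linearZ.
rewrite LF.
(* [pearson_op q] has degree at most [n], just low enough for evaluation at [xi] against [P_n] as
   well as [P_{n+1}]; [sg] makes the two terms cancel. *)
rewrite !(christoffel_eval oP e0 ME) ?(leqW sA)//.
rewrite !(christoffel_massE oJ oP defL e0 ME) /sg.
move: (Jn0 n) (Jn0 n.+1) (nz n) => h1 h2 h3.
move: (k n) kn0 (k n.+1) => a ha a'.
by field; rewrite nat1r h1 h2 h3 nR0 ha.
Qed.

(** The polynomial multiplied by sigma is [P_n' / n], whose top coefficient is 1. *)
Lemma coherence_relation_uniq n (s1 s2 : R) : (0 < n)%N ->
  coherence_relation P T n s1 -> coherence_relation P T n s2 -> s1 = s2.
Proof.
case: n => [//|n] _; rewrite /coherence_relation => -> h2.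
have /(congr1 (fun p : {poly R} => p`_n)) := h2.
rewrite !coefB !coefZ.
rewrite [in X in _ - X = _]coef_deriv [in X in _ = _ - X]coef_deriv.
rewrite (orth_coef_top oP) => /addrI/oppr_inj.
have nz : n.+1%:R != 0 :> R by rewrite pnatr_eq0.
by rewrite mulVf// !mulr1.
Qed.

End Coherence.

(** * Explicit formulas for the coherent pair *)

Definition scalar_of (R : realType) (L : {poly R} -> R) (lin : scalar L) :
  {scalar {poly R}} := HB.pack L (GRing.isLinear.Build R {poly R} R *%R L lin).

Theorem theorem3p1 (R : realType) (alpha beta xi : R)
    (J T P : nat -> {poly R})
    (halpha : 0 < alpha) (hbeta : 0 < beta) (hxi : 1 < `|xi|)
    (hJ : is_monic_jacobi (alpha - 1) (beta - 1) J)
    (hT : monic_orthogonal (c1 alpha beta) T)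
    (hP : monic_orthogonal (c0 alpha beta xi) P) :
  let cJ := weight_functional (jacobi_weight (alpha - 1) (beta - 1)) in
  let k := sqnorm cJ J in
  let k0 := sqnorm (c0 alpha beta xi) P in
  [/\ forall n : nat,
        P n = (k n / (J n).[xi]) *: kernel_poly cJ J n xi,
      forall n : nat,
        k0 n = - eps xi * k n * ((J n.+1).[xi] / (J n).[xi])
    & forall (n : nat) (sigma : R), (1 <= n)%N ->
        coherence_relation P T n sigma <->
        sigma =
          4 * n%:R * (n%:R + alpha) * (n%:R + beta) * (n%:R + alpha + beta - 1)
          / ((2 * n%:R + alpha + beta - 1) * (2 * n%:R + alpha + beta) ^+ 2
             * (2 * n%:R + alpha + beta + 1))
          * ((J n).[xi] / (J n.+1).[xi])].
Proof.
move=> cJ k k0.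
have a1 : -1 < alpha - 1 by lra.
have b1 : -1 < beta - 1 by lra.
have e0 : eps xi != 0.
  by rewrite /eps; case: ifP => _; rewrite ?oppr_eq0 oner_eq0.
have linJ : scalar cJ by exact: scalar_jacobi_functional.
have ME p : c0 alpha beta xi p = eps xi * cJ (('X - xi%:P) * p) by exact: c0E.
have NE p : c1 alpha beta p = cJ ((1 - 'X^2) * p) by exact: c1E.
have linM : scalar (c0 alpha beta xi).
  by move=> a p q; rewrite !ME mulrDr -scalerAr linJ; ring.
have linN : scalar (c1 alpha beta).
  by move=> a p q; rewrite !NE mulrDr -scalerAr linJ.
(* The packaged functionals are convertible to the original ones, so the orthogonality hypotheses
   transfer as they stand. *)
pose L := scalar_of linJ; pose M := scalar_of linM; pose N := scalar_of linN.
have oJ : monic_orthogonal L J by exact: hJ.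
have oP : monic_orthogonal M P by exact: hP.
have oT : monic_orthogonal N T by exact: hT.
have defL p : L (p ^+ 2) = 0 -> p = 0 by exact: jacobi_functional_definite.
have defN p : N (p ^+ 2) = 0 -> p = 0.
  by apply: jacobi_functional_definite; lra.
have pearsonL p : L (pearson_op (beta - alpha) (alpha + beta) p) = 0.
  have -> : beta - alpha = (beta - 1) - (alpha - 1) by ring.
  have -> : alpha + beta = alpha - 1 + (beta - 1) + 2 by ring.
  exact: jacobi_pearson.
split=> [n|n|n sigma n1].
- exact: (christoffel_kernel oJ oP defL e0 ME).
- exact: (christoffel_sqnorm oJ oP defL e0 ME).
have ex := coherence_relation_ex oJ oP oT defL defN pearsonL e0 ME NE n1.
set rhs := _ * _.
(* The factor [n / (n + 1)] turns the [n + 1] in the numerator of the norm ratio into [n]. *)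
have <- : n%:R / n.+1%:R * (sqnorm L J n.+1 / sqnorm L J n) *
    ((J n).[xi] / (J n.+1).[xi]) = rhs.
  rewrite /rhs; congr (_ * _); case: n n1 {ex rhs} => [//|m] _.
  rewrite (jacobi_sqnorm_ratio m halpha hbeta oJ defL pearsonL).
  rewrite mulfK ?(sqnorm_neq0 oJ _ defL)// -[m.+2%:R]natr1.
  have : 1 <= m.+1%:R :> R by rewrite ler1n.
  move: (m.+1%:R : R) => t t0.
  by field; repeat (apply/andP; split); lra.
by split=> [h|->//]; exact: (coherence_relation_uniq oP n1 h ex).
Qed.
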